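(* Let $K$ be a subgraph of a finite graph $G$, and let $\beta:C(G)\to C(K)$ be the map defined in the context. Then: (1) $\beta:C(G)\to C(K)$ is a degree preserving chain map; therefore (2) it induces a degree preserving homomorphism $\beta^*:H^i(G)\to H^i(K)$ for each $i$; (3) this correspondence is natural: if $L\subseteq K\subseteq G$ are subgraphs and $\beta^*,\beta_1^*,\beta_2^*$ are the homomorphisms induced by the inclusions $L\subseteq G$, $L\subseteq K$, $K\subseteq G$ respectively, then $\beta^*=\beta_1^*\circ\beta_2^*:H^*(G)\to H^*(L)$.
   Context: Graphs are finite, loops and multiple edges allowed; a subgraph $K\subseteq G$ has $V(K)\subseteq V(G)$, $E(K)\subseteq E(G)$, and edges of $K$ are ordered by the restriction of the ordering of $E(G)$. $A=\mathbb{Z}[x]/(x^2)$, $B=\mathbb{Z}[y]/(y^2)$, bigraded with $\deg x=(1,0)$, $\deg y=(0,1)$. For a graph $G$ with ordered edges $e_1,\dots,e_n$ and $s\subseteq E(G)$, $[G:s]$ is the spanning subgraph (vertex set $V(G)$, edge set $s$), with $b_0(s)$ components and first Betti number $b_1(s)$; $C^s(G)=A^{\otimes b_0(s)}\otimes B^{\otimes b_1(s)}$ (one $A$ factor per component), $C^i(G)=\bigoplus_{|s|=i}C^s(G)$; for $e_j\notin s$ the per-edge map $d_{s,j}:C^s(G)\to C^{s\cup\{e_j\}}(G)$ multiplies the $A$ factors of the two components joined by $e_j$ if they are distinct (identity elsewhere), and otherwise is the identity on $A$ factors and $b\mapsto b\otimes 1$ on $B^{\otimes b_1(s)}$; $d^i=\sum_{|s|=i}\sum_{e_j\notin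 s}(-1)^{|\{k<j:e_k\in s\}|}d_{s,j}$; $H^i$ is its cohomology. The map $\beta:C^i(G)\to C^i(K)$ is defined summand-wise: if $s\not\subseteq E(K)$, $\beta|_{C^s(G)}=0$; if $s\subseteq E(K)$, then $[G:s]$ is $[K:s]$ together with the $l=|V(G)\setminus V(K)|$ remaining vertices as isolated vertices, so $C^s(G)\cong C^s(K)\otimes A^{\otimes l}$; writing $A^{\otimes l}=A_0\oplus A_1$ where $A_0\cong\mathbb{Z}$ is spanned by $1\otimes\cdots\otimes1$ and $A_1$ is spanned by the other tensor products of basis elements $1,x$, set $\beta(g\otimes1\otimes\cdots\otimes1)=g$ and $\beta(g\otimes a)=0$ for $g\in C^s(K)$, $a\in A_1$. *)

(* Defs.v *)
From HB Require Import structures.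
From mathcomp Require Import all_boot all_order all_algebra.
From mathcomp Require Import qpoly generic_quotient ring_quotient boolp.

Set Implicit Arguments.
Unset Strict Implicit.
Unset Printing Implicit Defensive.

Import Order.TTheory GRing.Theory.
Local Open Scope ring_scope.

(* Finite direct sums of Z-modules: the library only has the constant-family
   case {ffun I -> M}. *)
Section DirectSum.
Variables (I : finType) (T : I -> zmodType).
Local Notation dsum := {dffun forall i, T i}.
Implicit Types f g h : dsum.

Definition dsum_zero : dsum := [ffun i => 0].
Definition dsum_opp f : dsum := [ffun i => - f i].
Definition dsum_add f g : dsum := [ffun i => f i + g i].

Fact dsum_addA : associative dsum_add.
Proof. by move=> f g h; apply/ffunP => i; rewrite !ffunE addrA. Qed.
Fact dsum_addC : commutative dsum_add.
Proof. by move=> f g; apply/ffunP => i; rewrite !ffunE addrC. Qed.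
Fact dsum_add0 : left_id dsum_zero dsum_add.
Proof. by move=> f; apply/ffunP => i; rewrite !ffunE add0r. Qed.
Fact dsum_addN : left_inverse dsum_zero dsum_opp dsum_add.
Proof. by move=> f; apply/ffunP => i; rewrite !ffunE addNr. Qed.

#[hnf] HB.instance Definition _ := GRing.isZmodule.Build dsum
  dsum_addA dsum_addC dsum_add0 dsum_addN.

Lemma dsum0E i : (0 : dsum) i = 0. Proof. by rewrite ffunE. Qed.
Lemma dsumNE f i : (- f) i = - f i. Proof. by rewrite ffunE. Qed.
Lemma dsumDE f g i : (f + g) i = f i + g i. Proof. by rewrite ffunE. Qed.
Lemma dsumBE f g i : (f - g) i = f i - g i. Proof. by rewrite !ffunE. Qed.

End DirectSum.

(* Both A = Z[x]/(x^2) and B = Z[y]/(y^2) are this ring; they only differ by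
   the name of the class 'qX of the variable and by its bidegree. *)
Notation sqz := {poly %/ ('X^2 : {poly int})}.
Notation sqz_gen := (@qpolyX int 'X^2).

Lemma sqz_gen_sqr : sqz_gen ^+ 2 = 0.
Proof.
rewrite /qpolyX -rmorphXn; apply/val_inj => /=.
by rewrite mk_monic_Xn Pdiv.RingMonic.rmodpp ?monicXn.
Qed.

Lemma sqz_genE : sqz_gen = 'X :> {poly int}.
Proof. by rewrite qpolyXE ?size_polyXn ?monicXn. Qed.

Lemma coef_sqz_gen (b b' : bool) : (sqz_gen ^+ b)`_b' = (b == b')%:R :> int.
Proof.
case: b; first by rewrite (expr1 sqz_gen) sqz_genE coefX; case: b'.
by rewrite (expr0 sqz_gen) coefC; case: b'.
Qed.

(* A monomial of A^{⊗I} ⊗ B^{⊗J}: the exponents in {0, 1} of x in each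
   of the A factors and of y in each of the B factors. *)
Notation monomial I J := ({ffun I -> bool} * {ffun J -> bool})%type.

(* A^{⊗I} ⊗ B^{⊗J}, as the free Z-module on its monomials. *)
Notation tensor I J := {ffun monomial I J -> int}.

(* The pure tensor of a family a of elements of A and a family b of elements
   of B. *)
Definition pure (I J : finType) (a : I -> sqz) (b : J -> sqz) : tensor I J :=
  [ffun m : monomial I J => (\prod_i (a i)`_(m.1 i)) * (\prod_j (b j)`_(m.2 j))].

Lemma pure_monomial (I J : finType) (m m' : monomial I J) :
  pure (fun i => sqz_gen ^+ m.1 i) (fun j => sqz_gen ^+ m.2 j) m'
    = (m == m')%:R.
Proof.
case: m m' => [p q] [p' q']; rewrite ffunE /= xpair_eqE -mulnb natrM.
have aux (K : finType) (u v : {ffun K -> bool}) :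
    \prod_k (sqz_gen ^+ u k)`_(v k) = (u == v)%:R :> int.
  under eq_bigr do rewrite coef_sqz_gen.
  have [->|neq] := eqVneq u v; first by rewrite big1 // => k _; rewrite eqxx.
  have [k uvk] : exists k, u k != v k.
    apply/existsP; rewrite -negb_forall; apply: contra neq => /forallP h.
    by apply/eqP/ffunP => k; apply/eqP.
  by rewrite (bigD1 k) //= (negPf uvk) mul0r.
by rewrite !aux.
Qed.

(* The linear map sending each monomial m to phi m. *)
Definition extend (I J : finType) (M : zmodType) (phi : monomial I J -> M)
  (u : tensor I J) : M := \sum_m phi m *~ u m.

Fact extend_is_zmod_morphism I J M phi :
  zmod_morphism (@extend I J M phi).
Proof.
move=> u v; rewrite /extend -sumrB.
by apply: eq_bigr => m _; rewrite !ffunE mulrzBr.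
Qed.
HB.instance Definition _ (I J : finType) (M : zmodType)
  (phi : monomial I J -> M) := GRing.isZmodMorphism.Build
  (tensor I J) M (extend phi) (@extend_is_zmod_morphism I J M phi).

Definition bidegree (I J : finType) (m : monomial I J) : nat * nat :=
  (#|[set i | m.1 i]|, #|[set j | m.2 j]|).

(* A family indexed by the elements of a type T satisfying P, seen as a family
   indexed by those satisfying Q: its value at an element that does not satisfy
   P is x0. *)
Definition reindex (T : Type) (P Q : pred T) (S : subType P) (S' : subType Q)
  (X : Type) (x0 : X) (f : S -> X) (j : S') : X := oapp f x0 (insub (val j)).

(* A graph with vertices in V and edges in the ordered type E. The end points
   of an edge form a set, with one element for a loop and two otherwise;
   distinct edges may have the same end points. *)
Record graph (V : finType) (disp : Order.disp_t) (E : finOrderType disp) :=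
  Graph {
    vset : {set V};
    eset : {set E};
    ends : E -> {set V};
    ends_vset : forall e, e \in eset -> ends e \subset vset;
    card_ends : forall e, e \in eset -> (0 < #|ends e| <= 2)%N }.

Section Graph.
Variables (V : finType) (disp : Order.disp_t) (E : finOrderType disp).
Implicit Types (G K : graph V E) (s t : {set E}).

Definition subgraph K G : bool :=
  [&& vset K \subset vset G, eset K \subset eset G
    & [forall e in eset K, ends K e == ends G e]].

(* [G:s] is the graph with vertex set vset G and edge set s, which is meant to
   be a subset of eset G. *)
Definition adjacent G s : rel V :=
  fun u v => [exists e in s, (u \in ends G e) && (v \in ends G e)].

Definition components G s : {set {set V}} :=
  equivalence_partition (connect (adjacent G s)) (vset G).

Definition component G s : Type := {c : {set V} | c \in components G s}.
HB.instance Definition _ G s := SubFinite.on (component G s).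

Definition b0 G s : nat := #|components G s|.

(* By the Euler characteristic: |vset G| - |s| = b0 - b1. The truncated
   subtraction is harmless since |vset G| <= |s| + b0. *)
Definition b1 G s : nat := (#|s| + b0 G s - #|vset G|)%N.

End Graph.

Notation Cs G s := (tensor (component G s) 'I_(b1 G s)).

Section Homology.
Variables (V : finType) (disp : Order.disp_t) (E : finOrderType disp).
Implicit Types (G K : graph V E) (s t : {set E}).

(* The map C^s(G) -> C^t(G), for t = s + {e}. The A factor of a component c' of
   [G:t] is the product of those of the components of [G:s] included in c':
   there are two of them if e joins them, otherwise c' itself is the only one.
   The B factors are kept, and if b1 G t = (b1 G s).+1 a last factor 1 is
   added. *)
Definition edge_map G s t : Cs G s -> Cs G t :=
  extend (fun m => pure
    (fun c' : component G t =>
       \prod_(c : component G s | val c \subset val c') sqz_gen ^+ m.1 c)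
    (reindex 1 (fun i : 'I_(b1 G s) => sqz_gen ^+ m.2 i))).

HB.instance Definition _ G s t := GRing.Additive.copy (@edge_map G s t)
  (extend _).

Definition layer G (i : nat) : Type :=
  {s : {set E} | (s \subset eset G) && (#|s| == i)}.
HB.instance Definition _ G i := SubFinite.on (layer G i).

Definition cochain G (i : nat) : zmodType :=
  {dffun forall s : layer G i, Cs G (val s)}.

Definition d G i (c : cochain G i) : cochain G i.+1 :=
  [ffun t : layer G i.+1 =>
    \sum_(s : layer G i)
      \sum_(e in eset G | (e \notin val s) && (e |: val s == val t))
        edge_map (val t) (c s) *~ (-1) ^+ #|[set f in val s | (f < e)%O]|].

Fact d_is_zmod_morphism G i : zmod_morphism (@d G i).
Proof.
move=> c c'; apply/ffunP => t; rewrite dsumBE !ffunE -sumrB.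
apply: eq_bigr => s _; rewrite -sumrB; apply: eq_bigr => e _.
by rewrite dsumBE raddfB mulrzBl.
Qed.
HB.instance Definition _ G i := GRing.isZmodMorphism.Build
  (cochain G i) (cochain G i.+1) (@d G i) (@d_is_zmod_morphism G i).

(* The summand of bidegree p, where deg x = (1, 0) and deg y = (0, 1). *)
Definition homogeneous G i (p : nat * nat) (c : cochain G i) : Prop :=
  forall (s : layer G i) (m : monomial _ _), c s m != 0 -> bidegree m = p.

Definition cocycle G i := fun c : cochain G i => d c == 0.
Fact cocycle_closed G i : zmod_closed (@cocycle G i).
Proof.
split=> [|c c' /eqP dc /eqP dc']; apply/eqP; first exact: raddf0.
by rewrite raddfB /= dc dc' subr0.
Qed.
HB.instance Definition _ G i := GRing.isZmodClosed.Build (cochain G i)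
  (@cocycle G i) (@cocycle_closed G i).

Record cocycles G i :=
  Cocycle { cocycle_val : cochain G i; _ : cocycle cocycle_val }.
HB.instance Definition _ G i := [isSub for @cocycle_val G i].
HB.instance Definition _ G i := [Choice of cocycles G i by <:].
HB.instance Definition _ G i := [SubChoice_isSubZmodule of cocycles G i by <:].

Definition coboundary G i : cochain G i -> Prop :=
  match i with
  | 0 => fun c => c = 0
  | j.+1 => fun c => exists b : cochain G j, d b = c
  end.

(* The image of d, as a subgroup of the kernel of d: as d o d = 0, restricting
   to cocycles removes nothing. *)
Definition coboundaries G i : {pred cocycles G i} :=
  [pred z | `[< coboundary (val z) >]].
Fact coboundaries_closed G i : zmod_closed (@coboundaries G i).
Proof.
case: i => [|i]; split=> [|z z' /asboolP /= bz /asboolP /= bz'];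
  apply/asboolP => //=.
- by rewrite bz bz' subr0.
- by exists 0; rewrite raddf0.
have [[b <-] [b' <-]] := (bz, bz').
by exists (b - b'); rewrite raddfB.
Qed.
HB.instance Definition _ G i := GRing.isZmodClosed.Build (cocycles G i)
  (@coboundaries G i) (@coboundaries_closed G i).

Definition cohomology G i := Quotient.quot (@coboundaries G i).
HB.instance Definition _ G i := GRing.Zmodule.on (cohomology G i).

Definition class G i (z : cocycles G i) : cohomology G i :=
  \pi_(Quotient.quot (@coboundaries G i))%qT z.
HB.instance Definition _ G i := GRing.Additive.copy (@class G i)
  (\pi_(Quotient.quot (@coboundaries G i))%qT).

Definition homogeneous_class G i (p : nat * nat) (h : cohomology G i) : Prop :=
  exists2 z : cocycles G i, homogeneous p (val z) & h = class z.

(* The component C^s(G) -> C^s(K) of beta for a set s of edges of K. The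
   components of [G:s] are those of [K:s] and the remaining vertices {v}. *)
Definition beta_s K G s : Cs G s -> Cs K s :=
  extend (fun m =>
    if [forall c : component G s, [disjoint val c & vset K] ==> ~~ m.1 c]
    then pure (reindex 1 (fun c : component G s => sqz_gen ^+ m.1 c))
              (reindex 1 (fun j : 'I_(b1 G s) => sqz_gen ^+ m.2 j))
    else 0).

HB.instance Definition _ K G s := GRing.Additive.copy (@beta_s K G s)
  (extend _).

Fact layer_subproof K G i (KG : subgraph K G) (s : layer K i) :
  (val s \subset eset G) && (#|val s| == i).
Proof.
case/and3P: KG => _ eKG _; case/andP: (valP s) => sK ->.
by rewrite (subset_trans sK eKG).
Qed.

Definition layer_incl K G i (KG : subgraph K G) (s : layer K i) : layer G i :=
  exist _ (val s) (layer_subproof KG s).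

(* The components of c indexed by the sets of edges of G that are not included
   in eset K are sent to 0. *)
Definition beta K G (KG : subgraph K G) i (c : cochain G i) : cochain K i :=
  [ffun s : layer K i => beta_s K (c (layer_incl KG s) : Cs G (val s))].

Fact beta_is_zmod_morphism K G (KG : subgraph K G) i :
  zmod_morphism (@beta K G KG i).
Proof.
by move=> c c'; apply/ffunP => s; rewrite dsumBE !ffunE -raddfB.
Qed.
HB.instance Definition _ K G (KG : subgraph K G) i :=
  GRing.isZmodMorphism.Build (cochain G i) (cochain K i) (@beta K G KG i)
    (@beta_is_zmod_morphism K G KG i).

(* f is the map induced in cohomology by the map phi between cochains: for
   every cocycle z, phi z is a cocycle and f [z] = [phi z]. *)
Definition induced_by G K i (phi : cochain G i -> cochain K i)
  (f : cohomology G i -> cohomology K i) : Prop :=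
  forall z : cocycles G i,
    exists2 w : cocycles K i, val w = phi (val z) & f (class z) = class w.

End Homology.

(* Main.v *)
(* In coordinates on monomials, beta is restriction along the injection that
   extends a monomial over K by exponent 0 on the components of [G:s] outside K.
   These components are isolated vertices, hence also components of [G:t] for
   s \subset t \subset E(K), and the edge maps act on their factors as the
   identity; so the matrix of the edge map of G, restricted to rows coming from
   K, vanishes outside the columns coming from K, where it is the matrix of the
   edge map of K. *)
Require Import Defs.
From HB Require Import structures.
From mathcomp Require Import all_boot all_order all_algebra.
From mathcomp Require Import generic_quotient ring_quotient boolp.

Set Implicit Arguments.
Unset Strict Implicit.
Unset Printing Implicit Defensive.

(* [Defs.reindex] would otherwise be shadowed by [bigop.reindex]. *)
Import Defs Order.TTheory GRing.Theory.
Local Open Scope ring_scope.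

(** * Big operators and families over two subtypes of one type *)

Section Reindex.
Variables (T : choiceType) (P Q : pred T).
Variables (S : subFinType P) (S' : subFinType Q).

(** Serves to compare products over components, and sums over edge sets, of [G] with those of [K].
    The indices satisfying [P] are matched with [S] by [insub]. *)
Lemma big_incl (R : Type) (idx : R) (op : Monoid.com_law idx) (h : S -> S')
    (F : S' -> R) :
    (forall i, val (h i) = val i) -> (forall j, ~~ P (val j) -> F j = idx) ->
  \big[op/idx]_j F j = \big[op/idx]_i F (h i).
Proof.
move=> hE F0; rewrite (bigID (fun j => P (val j))) /= [X in op _ X]big1 //.
rewrite Monoid.mulm1 (reindex_omap h (fun j => insub (val j))) => [|j Pj].
  by apply: eq_bigl => i; rewrite hE valK eqxx (valP i).
by rewrite insubT /=; congr Some; apply: val_inj; rewrite hE SubK.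
Qed.

Section Family.
Variables (X : Type) (x0 : X).

Lemma reindex_incl (h : S -> S') (f : S -> X) i :
  (forall i, val (h i) = val i) -> reindex x0 f (h i) = f i.
Proof. by move=> hE; rewrite /reindex hE valK. Qed.

Definition ffun_reindex (f : {ffun S -> X}) : {ffun S' -> X} :=
  [ffun k => reindex x0 f k].

Lemma ffun_reindexE f k : ffun_reindex f k = reindex x0 f k.
Proof. exact: ffunE. Qed.

End Family.

Lemma card_ffun_reindex (f : {ffun S -> bool}) : (forall x, P x -> Q x) ->
  #|[set j | ffun_reindex false f j]| = #|[set i | f i]|.
Proof.
move=> PQ; pose h (i : S) : S' := Sub (val i) (PQ _ (valP i)).
have hE i : val (h i) = val i by rewrite SubK.
rewrite -!sum1dep_card big_mkcond [RHS]big_mkcond (big_incl _ hE) /= => [|j Pj].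
  by apply: eq_bigr => i _; rewrite ffun_reindexE reindex_incl.
by rewrite ffun_reindexE /reindex insubN.
Qed.

End Reindex.

Arguments ffun_reindex {T P Q S S' X}.

Section ReindexComposition.
Variables (T : choiceType) (X : Type) (x0 : X).

Lemma ffun_reindex_id (P : pred T) (S : subFinType P) (f : {ffun S -> X}) :
  ffun_reindex x0 f = f.
Proof. by apply/ffunP => k; rewrite ffun_reindexE /reindex valK. Qed.

(** A value seen at both ends must survive the intermediate stage, whence the condition that [P] and
    [R] together imply [Q]. *)
Lemma ffun_reindex_comp (P Q R : pred T) (S : subFinType P) (S' : subFinType Q)
    (S'' : subFinType R) (f : {ffun S -> X}) :
  (forall x, P x -> R x -> Q x) ->
  ffun_reindex x0 (ffun_reindex x0 f : {ffun S' -> X})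
    = ffun_reindex x0 f :> {ffun S'' -> X}.
Proof.
move=> PRQ; apply/ffunP => k; rewrite !ffun_reindexE /reindex.
case: (insubP S' (val k)) => [j _ /= jE|nQ] /=; first by rewrite ffun_reindexE /reindex jE.
by case: insubP => // i Pi iE; rewrite PRQ ?(valP k) ?Pi in nQ.
Qed.

End ReindexComposition.

Lemma reindexX (T : Type) (P Q : pred T) (S : subType P) (S' : subType Q)
    (f : S -> bool) (k : S') :
  reindex 1 (fun i => sqz_gen ^+ f i) k = sqz_gen ^+ reindex false f k.
Proof. by rewrite /reindex; case: insub. Qed.

(** * Components and Betti numbers of a spanning subgraph with edges in [K] *)

Section Components.
Variables (V : finType) (disp : Order.disp_t) (E : finOrderType disp).
Implicit Types (G K : graph V E) (s t : {set E}).

Lemma adjacent_sym G s : symmetric (adjacent G s).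
Proof. by move=> u v; apply: eq_existsb => e; rewrite [X in _ && X]andbC. Qed.

Lemma components_partition G s : partition (components G s) (vset G).
Proof.
apply: equivalence_partitionP => x y z _ _ _; split=> //.
by move=> xy; rewrite (same_connect (sym_connect_sym (@adjacent_sym G s)) xy).
Qed.

Lemma component_neq0 G s c : c \in components G s -> c != set0.
Proof.
by move=> cG; apply: contraTneq cG => ->; case/and3P: (components_partition G s).
Qed.

Lemma component_subset G s c : c \in components G s -> c \subset vset G.
Proof.
move=> cG; case/and3P: (components_partition G s) => /eqP <- _ _.
exact: (bigcup_sup c).
Qed.

Lemma component_incl_eq G s c c' :
  c \in components G s -> c' \in components G s -> (c \subset c') = (c == c').
Proof.
move=> cG c'G; apply/idP/eqP => [cc'|-> //].
case/and3P: (components_partition G s) => _ /trivIsetP tr _.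
apply/eqP/contraT => /(tr _ _ cG c'G); rewrite -setI_eq0 (setIidPl cc').
by rewrite (negPf (component_neq0 cG)).
Qed.

Lemma eq_adjacent K G s : subgraph K G -> s \subset eset K ->
  adjacent G s =2 adjacent K s.
Proof.
case/and3P=> _ _ /forall_inP eKG sK u v; apply: eq_existsb => e.
by case: (boolP (e \in s)) => //= /(subsetP sK)/eKG/eqP ->.
Qed.

Lemma adjacent_vset K s u v : s \subset eset K -> adjacent K s u v -> u \in vset K.
Proof.
move=> sK /exists_inP[e /(subsetP sK) /ends_vset/subsetP eK /andP[ue _]].
exact: eK.
Qed.

(** Edges of [s] have their end points in [vset K], so no path can take a first step from [u]. *)
Lemma connect_outside K s u v : s \subset eset K -> u \notin vset K ->
  connect (adjacent K s) u v = (v == u).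
Proof.
move=> sK uK; apply/idP/eqP => [/connectP[[|w p] //=]|->]; last exact: connect0.
by case/andP=> /(adjacent_vset sK) /(negP uK).
Qed.

Lemma connect_vset K s u v : s \subset eset K -> u \in vset K ->
  connect (adjacent K s) u v -> v \in vset K.
Proof.
move=> sK uK uv; apply/contraT => vK.
move: uv; rewrite sym_connect_sym; last exact: adjacent_sym.
by rewrite (connect_outside _ sK vK) => /eqP uv; rewrite -uv uK in vK.
Qed.

(** Split [vset G] along [vset K]: the class of a vertex of [K] stays inside [K], and every other
    vertex is isolated. *)
Lemma components_subgraph K G s : subgraph K G -> s \subset eset K ->
  components G s
    = components K s :|: [set [set v] | v in vset G :\: vset K].
Proof.
move=> KG sK; have [vKG _ _] := and3P KG; have eqc := eq_connect (eq_adjacent KG sK).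
rewrite /components /equivalence_partition -{2}(setID (vset G) (vset K)) imsetU.
rewrite (setIidPr vKG); congr (_ :|: _); apply: eq_in_imset => u.
  move=> uK; apply/setP => v; rewrite !inE eqc; apply: andb_id2r.
  by move=> /(connect_vset sK uK) vK; rewrite vK (subsetP vKG).
case/setDP=> uG uK; apply/setP => v; rewrite !inE eqc (connect_outside _ sK uK).
by case: eqP => [->|_]; rewrite ?andbF // uG.
Qed.

Lemma mem_components_subgraph K G s c : subgraph K G -> s \subset eset K ->
  c \in components G s -> (c \in components K s) = ~~ [disjoint c & vset K].
Proof.
move=> KG sK; rewrite (components_subgraph KG sK) inE => cG; apply/idP/idP.
  move=> cK; rewrite -setI_eq0 (setIidPl (component_subset cK)).
  exact: component_neq0 cK.
case/orP: cG => // /imsetP[v /setDP[_ vK] ->].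
by rewrite disjoints1 vK.
Qed.

Lemma component_outside K G s t c :
    subgraph K G -> s \subset eset K -> t \subset eset K ->
  c \in components G s -> c \notin components K s -> c \in components G t.
Proof.
move=> KG sK tK; rewrite !(components_subgraph KG) // !inE.
by case/orP=> [->//|-> _]; rewrite orbT.
Qed.

(** Passing from [K] to [G] adds the same number of isolated vertices to the component count and to
    the vertex count. The two cancel, even in a truncated difference. *)
Lemma b1_subgraph K G s : subgraph K G -> s \subset eset K -> b1 K s = b1 G s.
Proof.
move=> KG sK; have [vKG _ _] := and3P KG.
rewrite /b1 /b0 (components_subgraph KG sK) cardsU.
rewrite (_ : _ :&: _ = set0); last first.
  apply/setP => c; rewrite !inE; apply/andP => -[/component_subset cK].
  by case/imsetP=> v /setDP[_ vK] cE; rewrite cE sub1set (negPf vK) in cK.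
rewrite cards0 subn0 (card_imset _ (@set1_inj V)).
rewrite -(cardsID (vset K) (vset G)) (setIidPr vKG) addnA.
by rewrite subnDr.
Qed.

End Components.

(** * Monomials over [K] and over [G], and the coordinates of [beta_s] *)

Section Beta.
Variables (V : finType) (disp : Order.disp_t) (E : finOrderType disp).
Implicit Types (G K L : graph V E) (s t : {set E}).
Local Notation exponents G s := (monomial (component G s) 'I_(b1 G s)).

(** Used in both directions: for [K] inside [G] it pads with exponent 0, and with the roles
    exchanged it restricts. On the [B] factors it replaces a cast between ordinals with equal but
    not convertible bounds. *)
Definition transfer K G s (m : exponents K s) : exponents G s :=
  (ffun_reindex false m.1, ffun_reindex false m.2).

Lemma transfer_comp L K G s (m : exponents L s) :
    subgraph L K -> s \subset eset L ->
  transfer G (transfer K m) = transfer G m.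
Proof.
move=> LK sL; congr (_, _); apply: ffun_reindex_comp => x xL _.
  by rewrite (components_subgraph LK sL) inE xL.
by rewrite -(b1_subgraph LK sL).
Qed.

Lemma transferK K G s : subgraph K G -> s \subset eset K ->
  cancel (@transfer K G s) (@transfer G K s).
Proof.
move=> KG sK [p q]; rewrite transfer_comp //.
by congr (_, _); apply: ffun_reindex_id.
Qed.

(* The monomials on which [beta_s] does not vanish. *)
Definition trivial_outside K G s (m : exponents G s) : bool :=
  [forall c : component G s, [disjoint val c & vset K] ==> ~~ m.1 c].

Lemma transfer_trivial_outside K G s (m : exponents K s) :
  subgraph K G -> s \subset eset K -> trivial_outside K (transfer G m).
Proof.
move=> KG sK; apply/forall_inP => c cK; rewrite ffun_reindexE /reindex.
by rewrite insubN // (mem_components_subgraph KG sK (valP c)) cK.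
Qed.

(** Restriction forgets only the exponents at components outside [K]; these are 0, which is what
    padding restores. *)
Lemma trivial_outsideK K G s (m : exponents G s) :
    subgraph K G -> s \subset eset K -> trivial_outside K m ->
  transfer G (transfer K m) = m.
Proof.
case: m => p q KG sK /forall_inP /= mK; congr (_, _); last first.
  rewrite /= ffun_reindex_comp ?ffun_reindex_id // => x.
  by rewrite (b1_subgraph KG sK).
apply/ffunP => c; rewrite ffun_reindexE /= /reindex; case: insubP => [c' _ c'E|cK] /=.
  by rewrite ffun_reindexE /= /reindex c'E valK.
rewrite (mem_components_subgraph KG sK (valP c)) negbK in cK.
by rewrite (negPf (mK c cK)).
Qed.

Lemma pure_reindex K G s (m : exponents G s) (m' : exponents K s) :
  pure (reindex 1 (fun c : component G s => sqz_gen ^+ m.1 c))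
       (reindex 1 (fun j : 'I_(b1 G s) => sqz_gen ^+ m.2 j)) m'
    = (transfer K m == m')%:R.
Proof.
rewrite -pure_monomial !ffunE.
by congr (_ * _); apply: eq_bigr => k _; rewrite reindexX ffun_reindexE.
Qed.

Lemma extendE (I J I' J' : finType) (phi : monomial I J -> tensor I' J')
    (u : tensor I J) m' :
  extend phi u m' = \sum_m phi m m' * u m.
Proof.
rewrite sum_ffunE; apply: eq_bigr => m _.
by rewrite ffunMzE mulrzz.
Qed.

(** In the row of [m], the matrix of [beta_s] has a single nonzero entry, equal to 1: a monomial
    trivial outside [K] is recovered from its restriction. *)
Lemma beta_sE K G s (u : Cs G s) (m : exponents K s) :
  subgraph K G -> s \subset eset K -> beta_s K u m = u (transfer G m).
Proof.
move=> KG sK; rewrite extendE (bigD1 (transfer G m)) //.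
rewrite ifT; last exact: transfer_trivial_outside.
rewrite (pure_reindex (transfer G m)) transferK // eqxx mul1r /= big1 ?addr0 // => m' neq.
case: ifP => [m'K|_]; last by rewrite !ffunE mul0r.
rewrite pure_reindex; case: eqP => [m'E|_]; last by rewrite mul0r.
by rewrite -m'E trivial_outsideK // eqxx in neq.
Qed.

Lemma bidegree_transfer K G s (m : exponents K s) :
  subgraph K G -> s \subset eset K -> bidegree (transfer G m) = bidegree m.
Proof.
move=> KG sK; congr (_, _); apply: card_ffun_reindex => x.
  by move=> xK; rewrite (components_subgraph KG sK) inE xK.
by rewrite (b1_subgraph KG sK).
Qed.

(** * Matrix coefficients of the edge maps *)

Lemma coefX_prod (I : finType) (a b : {ffun I -> bool}) :
  \prod_i (sqz_gen ^+ a i)`_(b i) = (a == b)%:R :> int.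
Proof.
under eq_bigr do rewrite coef_sqz_gen.
have [->|neq] := eqVneq a b; first by rewrite big1 // => i _; rewrite eqxx.
have [i abi] : exists i, a i != b i.
  apply/existsP; rewrite -negb_forall; apply: contra neq => /forallP h.
  by apply/eqP/ffunP => i; apply/eqP.
by rewrite (bigD1 i) //= (negPf abi) mul0r.
Qed.

Lemma edge_map_coef G s t (m : exponents G s) (m' : exponents G t) :
  pure (fun c' : component G t =>
         \prod_(c : component G s | val c \subset val c') sqz_gen ^+ m.1 c)
       (reindex 1 (fun i : 'I_(b1 G s) => sqz_gen ^+ m.2 i)) m'
  = (\prod_(c' : component G t)
       (\prod_(c : component G s | val c \subset val c')
           sqz_gen ^+ m.1 c)`_(m'.1 c'))
    * (ffun_reindex false m.2 == m'.2)%:R.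
Proof.
rewrite ffunE -coefX_prod; congr (_ * _); apply: eq_bigr => j _.
by rewrite reindexX ffun_reindexE.
Qed.

(** Compares the [B] parts of the edge maps of [G] and [K]. The bounds are variables so that the
    equalities of Betti numbers can be eliminated. *)
Lemma ffun_reindex_ord (a b a' b' : nat) (p : {ffun 'I_a -> bool})
    (q : {ffun 'I_b -> bool}) : a = a' -> b = b' ->
  (ffun_reindex false (ffun_reindex false p : {ffun 'I_a' -> bool})
     == ffun_reindex false q :> {ffun 'I_b' -> bool})
  = (ffun_reindex false p == q).
Proof. by move=> <- <-; rewrite !ffun_reindex_id. Qed.

(** Some isolated vertex outside [K] carries an [x] in [m]. It is still a component of [[G:t]],
    where its factor [x] has coefficient 0 at the exponent 0 of the padded monomial. *)
Lemma edge_map_coef_eq0 K G s t (m : exponents G s) (m' : exponents K t) :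
    subgraph K G -> s \subset t -> t \subset eset K -> ~~ trivial_outside K m ->
  \prod_(c' : component G t)
    (\prod_(c : component G s | val c \subset val c')
        sqz_gen ^+ m.1 c)`_((transfer G m').1 c') = 0 :> int.
Proof.
move=> KG st tK; have sK := subset_trans st tK.
rewrite negb_forall => /existsP[c]; rewrite negb_imply negbK => /andP[cK mc].
have cs : val c \notin components K s.
  by rewrite (mem_components_subgraph KG sK (valP c)) cK.
have ct : val c \in components G t.
  exact: (component_outside KG sK tK (valP c) cs).
pose c' : component G t := exist _ (val c) ct.
(* The only component of [[G:s]] contained in [c] is [c] itself. *)
rewrite (bigD1 c') //= (big_pred1 c) => [|c2]; last first.
  by rewrite /= (component_incl_eq (valP c2) (valP c)).
rewrite mc coef_sqz_gen ffunE /reindex insubN ?mul0r //=.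
by rewrite (mem_components_subgraph KG tK ct) cK.
Qed.

(** Both the inner and the outer product reduce to components of [K], because the padded exponents
    make every other factor 1. *)
Lemma edge_map_coef_transfer K G s t (m : exponents K s) (m' : exponents K t) :
    subgraph K G -> s \subset t -> t \subset eset K ->
  \prod_(c' : component G t)
    (\prod_(c : component G s | val c \subset val c')
        sqz_gen ^+ (transfer G m).1 c)`_((transfer G m').1 c')
  = \prod_(c' : component K t)
      (\prod_(c : component K s | val c \subset val c')
          sqz_gen ^+ m.1 c)`_(m'.1 c') :> int.
Proof.
move=> KG st tK; have sK := subset_trans st tK.
have incl (r : {set E}) c : r \subset eset K -> c \in components K r -> c \in components G r.
  by move=> rK cK; rewrite (components_subgraph KG rK) inE cK.
pose h (r : {set E}) (rK : r \subset eset K) (c : component K r) : component G r :=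
  exist _ (val c) (incl r _ rK (valP c)).
rewrite (big_incl _ (h := h t tK)) // => [|c' c'K].
  apply: eq_bigr => c' _; rewrite ffun_reindexE reindex_incl //; congr ((_ : sqz)`_ _).
  rewrite big_mkcond [RHS]big_mkcond /= (big_incl _ (h := h s sK)) // => [|c cK].
    by apply: eq_bigr => c _; rewrite ffun_reindexE reindex_incl.
  by rewrite ffun_reindexE /reindex insubN // if_same.
(* For [c'] outside [K], the components of [[G:s]] inside it also avoid [K]. The factor is thus the
   constant coefficient of 1. *)
have -> : (transfer G m').1 c' = false by rewrite ffun_reindexE /reindex insubN.
rewrite big1 => [|c cc'].
  exact: (coef_sqz_gen false false).
rewrite ffun_reindexE /reindex insubN //.
rewrite (mem_components_subgraph KG tK (valP c')) negbK in c'K.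
by rewrite (mem_components_subgraph KG sK (valP c)) (disjointWl cc' c'K).
Qed.

Lemma edge_map_beta_s K G s t (u : Cs G s) :
    subgraph K G -> s \subset t -> t \subset eset K ->
  edge_map t (beta_s K u) = beta_s K (edge_map t u).
Proof.
move=> KG st tK; have sK := subset_trans st tK.
apply/ffunP => m'; rewrite beta_sE // !extendE.
(* Monomials not trivial outside [K] contribute 0; the others are the paddings of the monomials over
   [K]. *)
rewrite (bigID (@trivial_outside K G s)) /= [X in _ + X]big1 ?addr0; last first.
  by move=> m mK; rewrite edge_map_coef edge_map_coef_eq0 // !mul0r.
rewrite (reindex_onto (@transfer K G s) (@transfer G K s)); last first.
  by move=> m; apply: trivial_outsideK.
apply: eq_big => [m|m _]; first by rewrite transfer_trivial_outside // transferK ?eqxx.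
rewrite beta_sE // !edge_map_coef edge_map_coef_transfer //; congr (_ * (nat_of_bool _)%:R * _).
by apply/esym/ffun_reindex_ord; apply: b1_subgraph.
Qed.

(** * Compatibility of [beta] with differentials, bidegrees and composition *)

Lemma beta_chain_map K G (KG : subgraph K G) i (c : cochain G i) :
  d (beta KG c) = beta KG (d c).
Proof.
have [_ eKG _] := and3P KG.
apply/ffunP => t; rewrite !ffunE raddf_sum /=; have /andP[tK _] := valP t.
(* Reduce the sum over layers of [G] to layers of [K]. The signs agree because both graphs order
   their edges by [E]. *)
rewrite [RHS](big_incl _ (h := @layer_incl _ _ _ K G i KG)) // => [|s sK].
  apply: eq_bigr => s _; rewrite raddf_sum; apply: eq_big => [e|e].
    (* An edge [e] with [e |: s = t] lies in [eset K], hence in [eset G], so both sums run over the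
       same edges. *)
    case: eqP => [et|_]; last by rewrite !andbF.
    have et' : e \in sval t by rewrite -et setU11.
    by rewrite (subsetP tK) ?(subsetP eKG) ?(subsetP tK).
  case/and3P=> _ _ /eqP et; rewrite raddfMz /= ffunE edge_map_beta_s //.
  by rewrite -et subsetUr.
(* A set [s] with a nonempty inner sum satisfies [s \subset t], hence is a layer of [K]. *)
rewrite raddf_sum big1 // => e /and3P[_ _ /eqP et]; have /andP[_ si] := valP s.
have st : sval s \subset sval t by rewrite -et subsetUr.
by case/negP: sK; rewrite si andbT (subset_trans st tK).
Qed.

Lemma betaE K G (KG : subgraph K G) i (c : cochain G i) (s : layer K i) m :
  beta KG c s m = c (layer_incl KG s) (transfer G m).
Proof. by have /andP[sK _] := valP s; rewrite ffunE beta_sE. Qed.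

Lemma beta_homogeneous K G (KG : subgraph K G) i p (c : cochain G i) :
  homogeneous p c -> homogeneous p (beta KG c).
Proof.
move=> cp s m; rewrite betaE => /(cp (layer_incl KG s) (transfer G m)) <-.
by have /andP[sK _] := valP s; rewrite bidegree_transfer.
Qed.

Lemma beta_comp L K G (LK : subgraph L K) (KG : subgraph K G)
    (LG : subgraph L G) i (c : cochain G i) :
  beta LK (beta KG c) = beta LG c.
Proof.
apply/ffunP => s; have /andP[sL _] := valP s; apply/ffunP => m.
rewrite !betaE transfer_comp //.
(* The two inclusions of [s] into the layers of [G] differ only in their proofs of a boolean
   condition. *)
have irr (p q : (val s \subset eset G) && (#|val s| == i)) :
    c (exist _ (val s) p) (transfer G m) = c (exist _ (val s) q) (transfer G m).
  by rewrite (bool_irrelevance p q).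
exact: irr.
Qed.

(** * Passage to cohomology *)

Lemma class_eq G i (z w : cocycles G i) :
  (class z = class w) <-> (z - w \in @coboundaries _ _ _ G i).
Proof.
by rewrite Quotient.idealrBE; split=> [zw|/eqP //]; apply/eqP.
Qed.

Lemma class_surj G i (h : cohomology G i) : exists z, h = class z.
Proof. by exists (repr h); rewrite /class reprK. Qed.

Lemma beta_cocycle K G (KG : subgraph K G) i (z : cocycles G i) :
  cocycle (beta KG (val z)).
Proof.
by rewrite /cocycle beta_chain_map (eqP (valP z)) raddf0.
Qed.

Definition cocycle_beta K G (KG : subgraph K G) i (z : cocycles G i) :
  cocycles K i := Cocycle (beta_cocycle KG z).

(** By additivity it is enough that [beta] preserves coboundaries. Degree 0 is separate, since there
    only 0 is a coboundary. *)
Lemma class_cocycle_beta K G (KG : subgraph K G) i (z w : cocycles G i) :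
  class z = class w -> class (cocycle_beta KG z) = class (cocycle_beta KG w).
Proof.
rewrite !class_eq => /asboolP /= zw; apply/asboolP; move: zw.
rewrite /= -raddfB; move: (_ - _) => {z w}.
case: i => [|i] c /=; first by move->; rewrite raddf0.
by case=> b <-; exists (beta KG b); rewrite beta_chain_map.
Qed.

Definition cohomology_beta K G (KG : subgraph K G) i (h : cohomology G i) :
  cohomology K i := class (cocycle_beta KG (repr h)).

Lemma cohomology_beta_class K G (KG : subgraph K G) i (z : cocycles G i) :
  cohomology_beta KG (class z) = class (cocycle_beta KG z).
Proof. by apply: class_cocycle_beta; rewrite /class reprK. Qed.

Fact cohomology_beta_is_zmod_morphism K G (KG : subgraph K G) i :
  zmod_morphism (@cohomology_beta K G KG i).
Proof.
move=> h h'; have [[z ->] [z' ->]] := (class_surj h, class_surj h').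
rewrite -raddfB !cohomology_beta_class -raddfB; congr class.
by apply: val_inj; rewrite /= raddfB.
Qed.

HB.instance Definition _ K G (KG : subgraph K G) i :=
  GRing.isZmodMorphism.Build (cohomology G i) (cohomology K i)
    (@cohomology_beta K G KG i) (@cohomology_beta_is_zmod_morphism K G KG i).

End Beta.

Theorem theorem6p6 (V : finType) (disp : Order.disp_t) (E : finOrderType disp)
  (G K : graph V E) (KG : subgraph K G) :
  [/\ (* beta is a degree preserving chain map *)
      (forall (i : nat) (c : cochain G i),
         d (beta KG c) = beta KG (d c)) /\
      (forall (i : nat) (p : nat * nat) (c : cochain G i),
         homogeneous p c -> homogeneous p (beta KG c)),
      (* beta induces degree preserving homomorphisms in cohomology *)
      (forall i : nat,
         exists2 f : {additive cohomology G i -> cohomology K i},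
           induced_by (beta KG (i := i)) f &
           forall (p : nat * nat) (h : cohomology G i),
             homogeneous_class p h -> homogeneous_class p (f h))
    & (* naturality *)
      forall (L : graph V E) (LK : subgraph L K) (LG : subgraph L G) (i : nat)
        (f : {additive cohomology G i -> cohomology L i})
        (f1 : {additive cohomology K i -> cohomology L i})
        (f2 : {additive cohomology G i -> cohomology K i}),
        induced_by (beta LG (i := i)) f ->
        induced_by (beta LK (i := i)) f1 ->
        induced_by (beta KG (i := i)) f2 ->
        forall h : cohomology G i, f h = f1 (f2 h)].
Proof.
split; first by split=> [|i p c]; [exact: beta_chain_map | exact: beta_homogeneous].
  move=> i; exists (@cohomology_beta _ _ _ K G KG i) => [z|p h [z zp ->]].
    by exists (cocycle_beta KG z); rewrite //= cohomology_beta_class.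
  exists (cocycle_beta KG z); last exact: cohomology_beta_class.
  exact: beta_homogeneous.
move=> L LK LG i f f1 f2 fE f1E f2E h; have [z ->] := class_surj h.
(* Each induced map is computed on a representative; the cocycles representing the two sides are
   then equal as cochains by [beta_comp]. *)
have [w wE ->] := fE z; have [w2 w2E ->] := f2E z; have [w1 w1E ->] := f1E w2.
by congr class; apply: val_inj; rewrite wE w1E w2E beta_comp.
Qed.
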